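(* Let $r\ge1$ and let $N$ be a nonzero proper ideal of $A$. The map $f\mapsto f|\gamma$, where $(f|\gamma)(\Lambda,\iota)=f(\Lambda,\gamma\circ\iota)$, is a right action of $\gamma\in\mathrm{GL}_r(A/N)$ on $\mathbf{Strong}_N^r$, which preserves the weight $k$ and maps cusp forms to cusp forms.
   Context: Setting. $F$ is a global function field of prime characteristic with field of constants $\mathbb F_q$; $\infty$ is a fixed place of $F$ of degree $\delta$; $A\subset F$ is the ring of elements regular away from $\infty$; $|\cdot|$ is the absolute value at $\infty$ with $|\pi|=q^{-\delta}$ for a uniformiser $\pi$; $F_\infty$ is the completion of $F$, and $\mathbb C_\infty$ is the completion of an algebraic closure of $F_\infty$. $\hat A$ is the profinite completion of $A$, and $\mathbb A_F^{fin}$ the ring of finite adeles (away from $\infty$). Lattices. A lattice is a finitely generated $A$-submodule $\Lambda\subset\mathbb C_\infty$ meeting every ball of finite radius in a finite set; its rank is its rank as a projective $A$-module. $\mathcal L_N^r$ is the set of pairs $(\Lambda,\alpha)$ with $\Lambda$ of rank $r$ and $\alpha:(N^{-1}/A)^r\to N^{-1}\Lambda/\Lambda$ an $A/N$-isomorphism. $\overleftarrow{\mathcal L_N^r}$ is the set of pairs $(\Lambda,\iota)$ with $\Lambda$ of rank $\le r$ and $\iota:N^{-1}\Lambda/\Lambda\to(N^{-1}/A)^r$ an injective $A/N$-module homomorphism; $\mathcal L_N^r$ is identified with the rank-$r$ part via $(\Lambda,\alpha)\leftrightarrow(\Lambda,\alpha^{-1})$. $t\in\mathbb C_\infty^\times$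 acts by $t(\Lambda,\iota)=(t\Lambda,\iota\circ t^{-1})$. $\mathrm{GL}_r(A/N)$ is viewed as the group of $A/N$-automorphisms of $(N^{-1}/A)^r$ and acts on $\overleftarrow{\mathcal L_N^r}$ by $\gamma(\Lambda,\iota)=(\Lambda,\gamma\circ\iota)$. Metric. $e_\Lambda(z)=z\prod_{0\ne\lambda\in\Lambda}(1-z/\lambda)$; $\mathrm d_{\mathcal L}(\Lambda_1,\Lambda_2)=\sup_{|z|\le1}|e_{\Lambda_1}(z)-e_{\Lambda_2}(z)|$; $\mu_{\Lambda,\iota}(l)=e_\Lambda(\iota^{-1}(l))^{-1}$ if $0\ne l\in\operatorname{Im}\iota$ and $0$ otherwise; the metric on $\overleftarrow{\mathcal L_N^r}$ is $\mathrm d_{\mathcal L}(\Lambda_1,\Lambda_2)+\sum_{l\in(N^{-1}/A)^r}|\mu_{\Lambda_1,\iota_1}(l)-\mu_{\Lambda_2,\iota_2}(l)|$. Analytic structure. $\Psi^r\subset\mathbb C_\infty^r$ is the set of row vectors with $F_\infty$-linearly independent entries, with the rigid analytic structure of $\Omega^r\times\mathbb C_\infty^\times$ via $\psi\mapsto([\psi],\psi_r)$, $\Omega^r$ being the Drinfeld period domain. For $\psi\in\Psi^r$, $g\in\mathrm{GL}_r(\mathbb A_F^{fin})$ let $\Theta([\psi,g])=(\Lambda,\alpha)$ with $\Lambda=\psi(F^r\cap g\hat A^r)$ and $\alpha$ the composite $(N^{-1}/A)^r\cong N^{-1}\hat A^r/\hat A^r\xrightarrow{g}N^{-1}g\hat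 A^r/g\hat A^r\cong N^{-1}(F^r\cap g\hat A^r)/(F^r\cap g\hat A^r)\xrightarrow{\psi}N^{-1}\Lambda/\Lambda$, unlabelled isomorphisms being induced by inclusions. A function $f$ on $\mathcal L_N^r$ is holomorphic if $\psi\mapsto f(\Theta([\psi,g]))$ is holomorphic on $\Psi^r$ for every $g$. Modular forms. $\mathbf{Strong}_N^{k,r}$ is the $\mathbb C_\infty$-space of functions $f:\overleftarrow{\mathcal L_N^r}\to\mathbb C_\infty$ that are continuous, homogeneous of degree $-k$ ($f(t(\Lambda,\iota))=t^{-k}f(\Lambda,\iota)$ for $t\in\mathbb C_\infty^\times$), and holomorphic on $\mathcal L_N^r$ (modular forms of weight $k$). Cusp forms are those with $f(\Lambda,\iota)=0$ whenever $\operatorname{rank}\Lambda<r$. $\mathbf{Strong}_N^r=\bigoplus_{k\ge0}\mathbf{Strong}_N^{k,r}$. *)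

(* Defs.v *)
From HB Require Import structures.
From mathcomp Require Import all_boot all_order all_algebra.
From mathcomp Require Import boolp classical_sets functions cardinality fsbigop.
From mathcomp Require Import reals.
From mathcomp Require mpoly.

Set Implicit Arguments.
Unset Strict Implicit.
Unset Printing Implicit Defensive.

Import Order.TTheory GRing.Theory Num.Theory.
Local Open Scope classical_set_scope.
Local Open Scope ring_scope.

(* A place is given by its normalised discrete valuation.  The value at 0,
   which should be +oo, is set to the junk value 0 so that distinct places are
   distinct functions; [val_ge v n x] is the meaningful test "v(x) >= n". *)
Record place (F : fieldType) := Place {
  pval :> F -> int;
  pval0 : pval 0 = 0;
  pvalM : forall x y, x != 0 -> y != 0 -> pval (x * y) = pval x + pval y;
  pvalD : forall x y, x != 0 -> y != 0 -> x + y != 0 ->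
    Num.min (pval x) (pval y) <= pval (x + y);
  pval_onto : exists2 x, x != 0 & pval x = 1
}.

Definition val_ge (F : fieldType) (v : place F) (n : int) (x : F) : bool :=
  (x == 0) || (n <= v x).

Section FunctionField.
Variables (k : finFieldType) (F : fieldType) (cst : {rmorphism k -> F}).

(* F is a finite extension of k(t) for some t transcendental over k, and k is
   algebraically closed in F. *)
Definition global_function_field : Prop :=
  (exists t : F, ~ algebraicOver cst t /\
    exists (n : nat) (b : 'I_n -> F), forall x, exists p q : 'I_n -> {poly k},
      (forall i, q i != 0) /\
      x = \sum_i (map_poly cst (p i)).[t] / (map_poly cst (q i)).[t] * b i)
  /\ (forall x, algebraicOver cst x -> exists c, x = cst c).

(* The family b maps to a k-basis of the residue field. *)
Definition place_degree (v : place F) (d : nat) : Prop :=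
  exists b : 'I_d -> F, (forall i, val_ge v 0 (b i)) /\
    forall x, val_ge v 0 x ->
      exists! c : {ffun 'I_d -> k}, val_ge v 1 (x - \sum_i cst (c i) * b i).

End FunctionField.

Section AbsoluteValues.
Variable R : realType.

Definition absolute_value (K : fieldType) (abs : K -> R) : Prop :=
  [/\ forall x, 0 <= abs x,
      forall x, (abs x == 0) = (x == 0),
      forall x y, abs (x * y) = abs x * abs y &
      forall x y, abs (x + y) <= Num.max (abs x) (abs y)].

Definition complete_for (K : fieldType) (abs : K -> R) : Prop :=
  forall u : nat -> K,
    (forall e, 0 < e -> exists n0, forall m n, (n0 <= m)%N -> (n0 <= n)%N ->
       abs (u m - u n) < e) ->
    exists l, forall e, 0 < e -> exists n0, forall n, (n0 <= n)%N ->
       abs (u n - l) < e.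

Record completion (K : fieldType) (absK : K -> R) := Completion {
  cfield :> fieldType;
  cemb : {rmorphism K -> cfield};
  cabs : cfield -> R;
  cabsP : absolute_value cabs;
  cemb_isom : forall x, cabs (cemb x) = absK x;
  cemb_dense : forall y e, 0 < e -> exists x, cabs (y - cemb x) < e;
  ccomplete : complete_for cabs
}.

(* |x| = q^(- d v(x)) *)
Definition place_abs (F : fieldType) (q : nat) (v : place F) (d : nat) (x : F)
    : R :=
  if x == 0 then 0 else (q%:R : R) ^ (- (d%:Z * v x)).

End AbsoluteValues.

(* The global data: F with its constants, the place infinity, and (models of)
   the completions F_oo, C_oo and F_p.  The scaling of the absolute value at
   the finite places only matters up to equivalence. *)
Record setting (R : realType) := Setting {
  const : finFieldType;
  F : fieldType;
  cst : {rmorphism const -> F};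
  F_global : global_function_field cst;
  infty : place F;
  delta : nat;
  deltaP : place_degree cst infty delta;
  Finf : completion (@place_abs R F #|const| infty delta);
  Fbar : closedFieldType;
  bemb : {rmorphism Finf -> Fbar};
  bemb_alg : forall x, algebraicOver bemb x;
  babs : Fbar -> R;
  babsP : absolute_value babs;
  bemb_isom : forall x, babs (bemb x) = cabs x;
  Cinf : completion babs;
  Floc : forall p : place F, completion (@place_abs R F #|const| p 1)
}.
Arguments Floc {R} s p.

Section Setting.
Variables (R : realType) (S : setting R).

Definition absC (z : Cinf S) : R := cabs z.
Definition absinf (x : Finf S) : R := cabs x.
Definition FinftoC (x : Finf S) : Cinf S := cemb (Cinf S) (bemb S x).
Definition FtoC (x : F S) : Cinf S := FinftoC (cemb (Finf S) x).
Definition abs_unif : R := #|const S|%:R ^ (- (delta S)%:Z).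

Definition regular (x : F S) : bool :=
  `[< forall p : place (F S), p <> infty S -> val_ge p 0 x >].

Lemma val_ge0_subring (p : place (F S)) : subring_closed (val_ge p 0).
Proof.
have v1 : p 1 = 0.
  have := @pvalM _ p 1 1 (oner_neq0 _) (oner_neq0 _).
  by rewrite mulr1 => /eqP; rewrite -subr_eq subrr eq_sym => /eqP.
have vM : {in val_ge p 0 &, forall x y, x * y \in val_ge p 0}.
  move=> x y; rewrite /in_mem /= /val_ge mulf_eq0.
  have [//|x0] := eqVneq x 0; have [//|y0] := eqVneq y 0.
  by rewrite /= pvalM //; exact: addr_ge0.
have vN1 : val_ge p 0 (-1).
  apply/orP; right.
  have n1 : (-1 : F S) != 0 by rewrite oppr_eq0 oner_neq0.
  have := pvalM p n1 n1; rewrite mulrNN mulr1 v1 => /esym/eqP.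
  by rewrite -mulr2n mulrn_eq0 /= => /eqP->.
split; last exact: vM; first by apply/orP; right; rewrite v1.
move=> x y hx hy.
have : val_ge p 0 (- y) by rewrite -mulN1r; apply: vM.
move: hx; rewrite /in_mem /=; move: (- y) => z; rewrite /val_ge.
have [->|x0] := eqVneq x 0; first by rewrite add0r.
have [->|z0] := eqVneq z 0; first by rewrite addr0 (negPf x0).
have [//|xz0] := eqVneq (x + z) 0 => /= hx hz.
by apply: (le_trans _ (pvalD p x0 z0 xz0)); rewrite le_min hx hz.
Qed.

Lemma regular_subring : subring_closed regular.
Proof.
split.
- by apply/asboolP => p _; case: (val_ge0_subring p).
- move=> x y /asboolP hx /asboolP hy; apply/asboolP => p pi.
  by case: (val_ge0_subring p) => _ h _; apply: h; [exact: hx|exact: hy].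
- move=> x y /asboolP hx /asboolP hy; apply/asboolP => p pi.
  by case: (val_ge0_subring p) => _ _ h; apply: h; [exact: hx|exact: hy].
Qed.

HB.instance Definition _ := GRing.isSubringClosed.Build (F S) regular
  regular_subring.

Record A := MkA { Aval : F S; AvalP : regular Aval }.
HB.instance Definition _ := [isSub for Aval].
HB.instance Definition _ := [Choice of A by <:].
HB.instance Definition _ := [SubChoice_isSubComNzRing of A by <:].

End Setting.

Section RestrictScalars.
Variables (R : realType) (S : setting R) (V : lmodType (F S)).

Definition resA : Type := V.
HB.instance Definition _ := GRing.Zmodule.on resA.
Definition resA_scale (a : A S) (v : resA) : resA := (val a) *: (v : V).
Lemma resA_scaleA a b v : resA_scale a (resA_scale b v) = resA_scale (a * b) v.
Proof. by rewrite /resA_scale scalerA. Qed.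
Lemma resA_scale1 : left_id 1 resA_scale.
Proof. by move=> v; rewrite /resA_scale scale1r. Qed.
Lemma resA_scaleDr : right_distributive resA_scale +%R.
Proof. by move=> a u v; rewrite /resA_scale scalerDr. Qed.
Lemma resA_scaleDl v : {morph resA_scale^~ v : a b / a + b}.
Proof. by move=> a b; rewrite /resA_scale scalerDl. Qed.
HB.instance Definition _ := GRing.Zmodule_isLmodule.Build (A S) resA
  resA_scaleA resA_scale1 resA_scaleDr resA_scaleDl.

End RestrictScalars.

Section CasFspace.
Variables (R : realType) (S : setting R).

Definition CF : Type := Cinf S.
HB.instance Definition _ := GRing.Zmodule.on CF.
Definition CF_scale (x : F S) (z : CF) : CF := FtoC x * (z : Cinf S).
Lemma CF_scaleA a b v : CF_scale a (CF_scale b v) = CF_scale (a * b) v.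
Proof. by rewrite /CF_scale mulrA /FtoC /FinftoC !rmorphM. Qed.
Lemma CF_scale1 : left_id 1 CF_scale.
Proof. by move=> v; rewrite /CF_scale /FtoC /FinftoC !rmorph1 mul1r. Qed.
Lemma CF_scaleDr : right_distributive CF_scale +%R.
Proof. by move=> a u v; rewrite /CF_scale mulrDr. Qed.
Lemma CF_scaleDl v : {morph CF_scale^~ v : a b / a + b}.
Proof. by move=> a b; rewrite /CF_scale /FtoC /FinftoC !rmorphD mulrDl. Qed.
HB.instance Definition _ := GRing.Zmodule_isLmodule.Build (F S) CF
  CF_scaleA CF_scale1 CF_scaleDr CF_scaleDl.

End CasFspace.

Section SubQuotient.
Variables (K : nzRingType) (V : lmodType K) (P Q : submodClosed V).

Record subm := Subm { subm_val : V; submP : subm_val \in P }.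
HB.instance Definition _ := [isSub for subm_val].
HB.instance Definition _ := [Choice of subm by <:].
HB.instance Definition _ := [SubChoice_isSubLmodule of subm by <:].

Definition subm_pre (x : subm) : bool := val x \in Q.
Lemma subm_pre_submod : submod_closed subm_pre.
Proof.
split; first by rewrite /in_mem /= /subm_pre raddf0 rpred0.
move=> a x y; rewrite /in_mem /= /subm_pre => hx hy.
by rewrite linearP /= rpredD // rpredZ.
Qed.
HB.instance Definition _ := GRing.isSubmodClosed.Build K subm subm_pre
  subm_pre_submod.

Definition subm_ker : zmodClosed subm :=
  GRing.ZmodClosed.clone subm subm_pre _.
(* P / (P \cap Q); in the uses below Q is contained in P *)
Definition subquot : Type := Quotient.quot subm_ker.
HB.instance Definition _ := GRing.Zmodule.on subquot.

Definition cls (x : subm) : subquot := (\pi_(Quotient.quot subm_ker) x)%qT.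
Definition rep (q : subquot) : subm := generic_quotient.repr (q : Quotient.quot subm_ker).

Lemma repK q : cls (rep q) = q.
Proof. exact: reprK. Qed.
Lemma cls_eq x y : cls x = cls y <-> val (x - y) \in Q.
Proof.
rewrite /cls; split=> [/eqP|h]; last apply/eqP; by rewrite -Quotient.idealrBE.
Qed.
Lemma clsD x y : cls (x + y) = cls x + cls y.
Proof. exact: raddfD. Qed.

Definition sq_scale (a : K) (q : subquot) : subquot := cls (a *: rep q).
Lemma sq_scale_cls a x : sq_scale a (cls x) = cls (a *: x).
Proof.
apply/cls_eq; rewrite -scalerBr linearZ /= rpredZ //.
exact/cls_eq/repK.
Qed.
Lemma sq_scaleA a b q : sq_scale a (sq_scale b q) = sq_scale (a * b) q.
Proof. by rewrite -[q]repK !sq_scale_cls scalerA. Qed.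
Lemma sq_scale1 : left_id 1 sq_scale.
Proof. by move=> q; rewrite -[q]repK sq_scale_cls scale1r. Qed.
Lemma sq_scaleDr : right_distributive sq_scale +%R.
Proof.
move=> a q s.
by rewrite -[q]repK -[s]repK -clsD !sq_scale_cls scalerDr clsD.
Qed.
Lemma sq_scaleDl q : {morph sq_scale^~ q : a b / a + b}.
Proof. by move=> a b; rewrite -[q]repK !sq_scale_cls scalerDl clsD. Qed.
HB.instance Definition _ := GRing.Zmodule_isLmodule.Build K subquot
  sq_scaleA sq_scale1 sq_scaleDr sq_scaleDl.

Lemma clsZ a x : cls (a *: x) = a *: cls x.
Proof. by rewrite -sq_scale_cls. Qed.

End SubQuotient.

Section Level.
Variables (R : realType) (S : setting R) (N : idealr (A S)).

Local Notation FA := (resA (F S)^o).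

Definition Ninv (x : FA) : bool :=
  `[< forall n : A S, n \in N -> regular (val n * (x : F S)) >].
Lemma Ninv_submod : submod_closed Ninv.
Proof.
have [_ regB regM] := @regular_subring _ S.
have regN1 : regular (-1 : F S) by have := AvalP (-1 : A S).
split=> [|a x y /asboolP hx /asboolP hy]; apply/asboolP => n nN.
  by rewrite mulr0; have := AvalP (0 : A S).
have -> : val n * ((a *: x + y : FA) : F S)
    = val a * (val n * x) - (-1 * (val n * y)).
  by rewrite mulN1r opprK mulrDr mulrCA.
apply: regB; apply: regM => //; [exact: AvalP|exact: hx|exact: hy].
Qed.
HB.instance Definition _ := GRing.isSubmodClosed.Build (A S) FA Ninv Ninv_submod.

Definition Aset (x : FA) : bool := regular (x : F S).
Lemma Aset_submod : submod_closed Aset.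
Proof.
have [_ regB regM] := @regular_subring _ S.
have regN1 : regular (-1 : F S) by have := AvalP (-1 : A S).
split=> [|a x y hx hy]; first by have := AvalP (0 : A S).
have -> : a *: x + y = (val a * (x : F S) - (-1 * (y : F S)) : F S).
  by rewrite mulN1r opprK.
by apply: regB; apply: regM => //; exact: AvalP.
Qed.
HB.instance Definition _ := GRing.isSubmodClosed.Build (A S) FA Aset Aset_submod.

Definition NinvP : submodClosed FA := GRing.SubmodClosed.clone _ _ Ninv _.
Definition AsetP : submodClosed FA := GRing.SubmodClosed.clone _ _ Aset _.

Definition NinvA : lmodType (A S) := subquot NinvP AsetP.

Section NinvMul.
Variables (V : lmodType (F S)) (M : set V).

(* the A-submodule N^-1 M generated by the products x m *)
Definition Ninv_mul (v : resA V) : bool :=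
  `[< exists s : seq (F S * V),
      (forall p, p \in s -> Ninv p.1 /\ M p.2) /\
      v = \sum_(p <- s) p.1 *: p.2 :> V >].
Lemma Ninv_mul_submod : submod_closed Ninv_mul.
Proof.
split=> [|a x y /asboolP[s [hs ex]] /asboolP[t [ht ey]]]; apply/asboolP.
  by exists [::]; rewrite big_nil.
exists ([seq (val a * p.1, p.2) | p <- s] ++ t); split.
  move=> p; rewrite mem_cat => /orP[/mapP[p' /hs[h1 h2] ->]|/ht//].
  split=> //=; have [_ h] := Ninv_submod.
  have := h a (p'.1 : FA) 0 h1; rewrite addr0; apply.
  by case: Ninv_submod.
rewrite big_cat big_map /= -ey; congr (_ + _).
rewrite /GRing.scale /= /resA_scale ex scaler_sumr.
by apply: eq_bigr => p _; rewrite scalerA.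
Qed.
HB.instance Definition _ := GRing.isSubmodClosed.Build (A S) (resA V)
  Ninv_mul Ninv_mul_submod.
Definition Ninv_mulP : submodClosed (resA V) :=
  GRing.SubmodClosed.clone _ _ Ninv_mul _.

End NinvMul.

(* A/N acts on N^-1/A through representatives: see Nkills and qact_pi. *)
Definition qact (c : {ideal_quot N}) (q : NinvA) : NinvA :=
  generic_quotient.repr c *: q.

Lemma Nkills (n : A S) (q : NinvA) : n \in N -> n *: q = 0.
Proof.
move=> nN; rewrite -[q]repK -clsZ.
have -> : (0 : NinvA) = cls AsetP 0 by apply/esym; exact: raddf0.
apply/cls_eq; rewrite subr0 /=.
case: (rep q) => x /= xN; exact: (asboolW xN) nN.
Qed.

Lemma qact_pi (a : A S) q : qact (\pi_{ideal_quot N} a)%qT q = a *: q.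
Proof.
rewrite /qact; apply/eqP; rewrite -subr_eq0 -scalerBl; apply/eqP/Nkills.
by rewrite Quotient.idealrBE reprK.
Qed.
Lemma qactA c d q : qact c (qact d q) = qact (c * d) q.
Proof.
elim/quotW: c => a; elim/quotW: d => b.
by rewrite !qact_pi scalerA -qact_pi !piE.
Qed.
Lemma qact1 q : qact 1 q = q.
Proof. by rewrite -[RHS]scale1r -qact_pi !piE. Qed.
Lemma qact0 q : qact 0 q = 0.
Proof. by rewrite -[RHS](scale0r q) -qact_pi !piE. Qed.
Lemma qactDl c d q : qact (c + d) q = qact c q + qact d q.
Proof.
elim/quotW: c => a; elim/quotW: d => b.
by rewrite !qact_pi -scalerDl -qact_pi !piE.
Qed.
Lemma qactDr c : {morph qact c : p q / p + q}.
Proof. by move=> p q; exact: scalerDr. Qed.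
Lemma qactC c a q : qact c (a *: q) = a *: qact c q.
Proof. by rewrite /qact !scalerA mulrC. Qed.

End Level.

Record GL (r : nat) (K : pzRingType) := MkGL {
  gmx :> 'M[K]_r;
  gmxP : exists h : 'M[K]_r, gmx *m h = 1%:M /\ h *m gmx = 1%:M
}.

Lemma GL1_subproof (r : nat) (K : pzRingType) :
  exists h : 'M[K]_r, 1%:M *m h = 1%:M /\ h *m 1%:M = 1%:M.
Proof. by exists 1%:M; rewrite !mul1mx. Qed.
Definition GL1 r K : GL r K := MkGL (GL1_subproof r K).

Lemma GLM_subproof (r : nat) (K : pzRingType) (g h : GL r K) :
  exists u : 'M[K]_r, (g *m h) *m u = 1%:M /\ u *m (g *m h) = 1%:M.
Proof.
case: g h => [g [g' [gg' g'g]]] [h [h' [hh' h'h]]] /=.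
exists (h' *m g'); split.
  by rewrite mulmxA -(mulmxA g) hh' mulmx1.
by rewrite mulmxA -(mulmxA h') g'g mulmx1.
Qed.
Definition GLM r (K : pzRingType) (g h : GL r K) : GL r K :=
  MkGL (GLM_subproof g h).

Section LevelStructures.
Variables (R : realType) (S : setting R) (N : idealr (A S)) (r : nat).

Definition Wr : lmodType (A S) := {ffun 'I_r -> NinvA N}.

Definition mxact (g : 'M[{ideal_quot N}]_r) (l : Wr) : Wr :=
  [ffun i => \sum_j qact (g i j) (l j)].

Lemma mxactM g h l : mxact g (mxact h l) = mxact (g *m h) l.
Proof.
apply/ffunP => i; rewrite !ffunE.
under eq_bigr => j _.
  rewrite ffunE (big_morph _ (qactDr (g i j)) (scaler0 _ _)).
  under eq_bigr => u _ do rewrite qactA.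
  over.
rewrite exchange_big; apply: eq_bigr => u _; rewrite mxE.
by rewrite (big_morph (fun c => qact c (l u)) (fun c d => qactDl c d _) (qact0 _)).
Qed.
Lemma mxact1 l : mxact 1%:M l = l.
Proof.
apply/ffunP => i; rewrite ffunE (bigD1 i) //= mxE eqxx qact1 big1 ?addr0 //.
by move=> j ji; rewrite mxE eq_sym (negPf ji) qact0.
Qed.
Lemma mxact_linear g : linear (mxact g).
Proof.
move=> a u v; apply/ffunP => i; rewrite !ffunE scaler_sumr -big_split /=.
by apply: eq_bigr => j _; rewrite !ffunE qactDr qactC.
Qed.
Lemma mxact_inj (g : GL r {ideal_quot N}) : injective (mxact g).
Proof.
case: g => g [h [_ hg]] /= u v e.
by rewrite -[u]mxact1 -[v]mxact1 -hg -!mxactM e.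
Qed.

Local Notation CA := (resA (CF S)).

Definition lin_indepA (n : nat) (v : 'I_n -> CA) : Prop :=
  forall a : 'I_n -> A S, \sum_i a i *: v i = 0 -> forall i, a i = 0.

Definition fin_gen (L : set CA) : Prop :=
  exists (n : nat) (v : 'I_n -> CA), (forall i, L (v i)) /\
    forall x, L x -> exists a : 'I_n -> A S, x = \sum_i a i *: v i.

Record lattice := Lattice {
  lat :> submodClosed CA;
  lat_fg : fin_gen [set x | x \in lat];
  lat_discrete : forall (c : Cinf S) (rho : R),
    finite_set [set z : Cinf S | z \in lat /\ absC (z - c) <= rho]
}.

(* rank of a torsion-free module: maximal number of independent elements *)
Definition has_rank (L : set CA) (n : nat) : Prop :=
  (exists v : 'I_n -> CA, (forall i, L (v i)) /\ lin_indepA v) /\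
  (forall m (v : 'I_m -> CA), (forall i, L (v i)) -> lin_indepA v -> (m <= n)%N).

Definition Ninv_lat (L : lattice) : submodClosed CA :=
  Ninv_mulP N [set z : CF S | z \in (L : {pred CA})].
Definition torsN (L : lattice) : lmodType (A S) := subquot (Ninv_lat L) L.

(* Both modules are killed by N, so A/N-linear means A-linear. *)
Record lpair := LPair {
  Lam : lattice;
  Lam_rank : exists2 n, has_rank [set x | x \in (Lam : {pred CA})] n & (n <= r)%N;
  iota : torsN Lam -> Wr;
  iota_linear : linear iota;
  iota_inj : injective iota
}.
Arguments iota : clear implicits.

Lemma glact_linear (g : GL r {ideal_quot N}) (x : lpair) :
  linear (mxact g \o iota x).
Proof. by move=> a u v /=; rewrite iota_linear mxact_linear. Qed.
Definition glact (g : GL r {ideal_quot N}) (x : lpair) : lpair :=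
  LPair (Lam_rank x) (@glact_linear g x)
    (inj_comp (@mxact_inj g) (@iota_inj x)).

End LevelStructures.
Arguments iota {R S N r} _ _.

Section Scaling.
Variables (R : realType) (S : setting R) (N : idealr (A S)) (r : nat).
Variables (t : Cinf S) (t0 : t != 0).

Local Notation CA := (resA (CF S)).

Definition scal (s : Cinf S) (z : CA) : CA := s * (z : Cinf S).
Lemma scal_linear s : linear (scal s).
Proof.
move=> a u v; rewrite /scal /GRing.scale /= /resA_scale /GRing.scale /=.
by rewrite /CF_scale mulrDr mulrCA.
Qed.
Lemma scalB s (u v : CA) : scal s (u - v) = scal s u - scal s v.
Proof. by rewrite /scal mulrBr. Qed.
Lemma scalZ s a v : scal s (a *: v) = a *: scal s v.
Proof.
have s0 : scal s 0 = 0 by rewrite /scal mulr0.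
by have := scal_linear s a v 0; rewrite s0 !addr0.
Qed.
Lemma scal_sum s n (a : 'I_n -> A S) (v : 'I_n -> CA) :
  scal s (\sum_i a i *: v i) = \sum_i a i *: scal s (v i).
Proof.
have s0 : scal s 0 = 0 by rewrite /scal mulr0.
have sD : {morph scal s : u w / u + w} by move=> u w; rewrite /scal mulrDr.
rewrite (big_morph (scal s) sD s0).
by apply: eq_bigr => i _; exact: scalZ.
Qed.
Lemma scalK z : scal t (scal t^-1 z) = z.
Proof. by rewrite /scal mulrA divff // mul1r. Qed.
Lemma scalVK z : scal t^-1 (scal t z) = z.
Proof. by rewrite /scal mulrA mulVf // mul1r. Qed.

Section Lat.
Variable L : lattice S.

Definition tlat_pred (z : CA) : bool := scal t^-1 z \in L.
Lemma tlat_submod : submod_closed tlat_pred.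
Proof.
split; first by rewrite /in_mem /= /tlat_pred /scal mulr0 (rpred0 L).
move=> a x y; rewrite /in_mem /= /tlat_pred scal_linear => hx hy.
by rewrite rpredD // rpredZ.
Qed.
HB.instance Definition _ := GRing.isSubmodClosed.Build (A S) CA tlat_pred
  tlat_submod.
Definition tlat_sub : submodClosed CA := GRing.SubmodClosed.clone _ _ tlat_pred _.

Lemma tlat_fg : fin_gen [set x | x \in tlat_sub].
Proof.
have [n [v [hv hg]]] := lat_fg L.
exists n, (fun i => scal t (v i)); split=> [i|x hx].
  by rewrite /= /in_mem /= /tlat_pred scalVK; exact: hv.
have [a e] := hg _ hx; exists a; rewrite -[x]scalK e.
by rewrite scal_sum.
Qed.

Lemma absC_M (x y : Cinf S) : absC (x * y) = absC x * absC y.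
Proof. by have [_ _ h _] := cabsP (Cinf S); exact: h. Qed.
Lemma absC_gt0 (x : Cinf S) : x != 0 -> 0 < absC x.
Proof.
have [h0 he _ _] := cabsP (Cinf S) => x0.
by rewrite lt_def [0 <= _]h0 andbT /absC he.
Qed.

Lemma tlat_discrete (c : Cinf S) (rho : R) :
  finite_set [set z : Cinf S | z \in tlat_sub /\ absC (z - c) <= rho].
Proof.
have h := finite_image (scal t) (lat_discrete L (t^-1 * c) (absC t^-1 * rho)).
apply: sub_finite_set h => z /= [hz hc].
exists (scal t^-1 z); last exact: scalK.
split; first exact: hz.
rewrite /scal -mulrBr absC_M ler_pM2l //.
by apply: absC_gt0; rewrite invr_eq0.
Qed.
Definition tlat : lattice S := Lattice tlat_fg tlat_discrete.

Lemma lin_indep_scal (s : Cinf S) n (v : 'I_n -> CA) : s != 0 ->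
  lin_indepA v -> lin_indepA (fun i => scal s (v i)).
Proof.
move=> s0 h a e; apply: h; move: e.
rewrite -scal_sum /scal => /eqP; rewrite mulf_eq0 (negPf s0) /= => /eqP.
exact.
Qed.

Lemma tlat_rank n : has_rank [set x | x \in (L : {pred CA})] n ->
  has_rank [set x | x \in (tlat : {pred CA})] n.
Proof.
move=> [[v [hv iv]] hm]; split.
  exists (fun i => scal t (v i)); split; last exact: lin_indep_scal.
  by move=> i; rewrite /= /in_mem /= /tlat_pred scalVK; exact: hv.
move=> m w hw iw; apply: (hm m (fun i => scal t^-1 (w i))) => //.
by apply: lin_indep_scal => //; rewrite invr_eq0.
Qed.

Lemma tNinv_sub (z : subm (Ninv_lat N tlat)) :
  scal t^-1 (val z) \in Ninv_lat N L.
Proof.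
case: z => z /= /asboolP[s [hs ->]]; apply/asboolP.
exists [seq (p.1, scal t^-1 p.2) | p <- s]; split.
  by move=> _ /mapP[p /hs[h1 h2] ->].
rewrite big_map /scal mulr_sumr; apply: eq_bigr => p _ /=.
by rewrite /GRing.scale /= /CF_scale mulrCA.
Qed.
Definition tinv_sub (z : subm (Ninv_lat N tlat)) : subm (Ninv_lat N L) :=
  Subm (tNinv_sub z).

Lemma tinv_sub_linear : linear tinv_sub.
Proof. by move=> a u v; apply: val_inj; rewrite /= scal_linear. Qed.

(* multiplication by t^-1 : N^-1 tL / tL -> N^-1 L / L *)
Definition tinv (q : torsN N tlat) : torsN N L := cls _ (tinv_sub (rep q)).

Lemma tinv_cls z : tinv (cls _ z) = cls _ (tinv_sub z).
Proof.
apply/cls_eq; have /cls_eq := repK (cls (tlat : submodClosed CA) z).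
rewrite /= {1}/in_mem /= /tlat_pred.
by rewrite scalB.
Qed.
Lemma tinv_linear : linear tinv.
Proof.
move=> a u v; rewrite -[u]repK -[v]repK -clsZ -clsD !tinv_cls.
by rewrite tinv_sub_linear clsD clsZ.
Qed.
Lemma tinv_inj : injective tinv.
Proof.
move=> u v; rewrite -[u]repK -[v]repK !tinv_cls => /cls_eq h; apply/cls_eq.
by rewrite /= {1}/in_mem /= /tlat_pred scalB.
Qed.

End Lat.

Lemma tact_rank (x : lpair N r) :
  exists2 n, has_rank [set z | z \in (tlat (Lam x) : {pred CA})] n & (n <= r)%N.
Proof. by have [n hn nr] := Lam_rank x; exists n => //; exact: tlat_rank. Qed.
Lemma tact_linear (x : lpair N r) : linear (iota x \o tinv (L := Lam x)).
Proof.
by move=> a u v /=; rewrite (tinv_linear a u v) (iota_linear a).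
Qed.
Definition tact (x : lpair N r) : lpair N r :=
  LPair (tact_rank x) (@tact_linear x) (inj_comp (@iota_inj _ _ _ _ x)
    (@tinv_inj (Lam x))).

End Scaling.

Section Metric.
Variables (R : realType) (S : setting R) (N : idealr (A S)) (r : nat).

Local Notation C := (Cinf S).
Local Notation CA := (resA (CF S)).

(* partial products over the finite sets of lattice points in balls *)
Definition lat_exp_approx (L : lattice S) (rho : R) (z : C) : C :=
  z * \big[*%R/1]_(l \in [set l : C | [/\ l \in (L : {pred CA}), l != 0
                                        & absC l <= rho]]) (1 - z / l).

Definition is_lat_exp (L : lattice S) (z w : C) : Prop :=
  forall e : R, 0 < e -> exists rho0, forall rho, rho0 <= rho ->
    absC (lat_exp_approx L rho z - w) < e.

(* e_Lambda(z), the limit of the partial products *)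
Definition lat_exp (L : lattice S) (z : C) : C := xget 0 [set w | is_lat_exp L z w].

Definition dist_lat (L1 L2 : lattice S) : R :=
  sup [set absC (lat_exp L1 z - lat_exp L2 z) | z in [set z : C | absC z <= 1]].

Definition mu (x : lpair N r) (l : Wr N r) : C :=
  if `[< l <> 0 /\ exists m : torsN N (Lam x), iota x m = l >] then
    (lat_exp (Lam x)
       (val (rep (xget 0 [set m : torsN N (Lam x) | iota x m = l])) : C))^-1
  else 0.

Definition dist (x y : lpair N r) : R :=
  dist_lat (Lam x) (Lam y) +
  \sum_(l \in [set: Wr N r]) absC (mu x l - mu y l).

End Metric.

Section Adeles.
Variables (R : realType) (S : setting R).

Definition finplace := {p : place (F S) | p <> infty S}.

Definition prodF : Type := forall p : finplace, Floc S (sval p).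
HB.instance Definition _ := Choice.on prodF.

Definition prodF_add (x y : prodF) : prodF := fun p => x p + y p.
Definition prodF_opp (x : prodF) : prodF := fun p => - x p.
Definition prodF_mul (x y : prodF) : prodF := fun p => x p * y p.
Definition prodF_zero : prodF := fun p => 0.
Definition prodF_one : prodF := fun p => 1.

Lemma prodF_addA : associative prodF_add.
Proof. by move=> x y z; apply: functional_extensionality_dep => p; exact: addrA. Qed.
Lemma prodF_addC : commutative prodF_add.
Proof. by move=> x y; apply: functional_extensionality_dep => p; exact: addrC. Qed.
Lemma prodF_add0 : left_id prodF_zero prodF_add.
Proof. by move=> x; apply: functional_extensionality_dep => p; exact: add0r. Qed.
Lemma prodF_addN : left_inverse prodF_zero prodF_opp prodF_add.
Proof. by move=> x; apply: functional_extensionality_dep => p; exact: addNr. Qed.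
Lemma prodF_mulA : associative prodF_mul.
Proof. by move=> x y z; apply: functional_extensionality_dep => p; exact: mulrA. Qed.
Lemma prodF_mulC : commutative prodF_mul.
Proof. by move=> x y; apply: functional_extensionality_dep => p; exact: mulrC. Qed.
Lemma prodF_mul1 : left_id prodF_one prodF_mul.
Proof. by move=> x; apply: functional_extensionality_dep => p; exact: mul1r. Qed.
Lemma prodF_mulDl : left_distributive prodF_mul prodF_add.
Proof. by move=> x y z; apply: functional_extensionality_dep => p; exact: mulrDl. Qed.

HB.instance Definition _ := GRing.isZmodule.Build prodF
  prodF_addA prodF_addC prodF_add0 prodF_addN.
HB.instance Definition _ := GRing.Zmodule_isComPzRing.Build prodF
  prodF_mulA prodF_mulC prodF_mul1 prodF_mulDl.

Definition principal (x : F S) : prodF := fun p => cemb (Floc S (sval p)) x.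

(* the profinite completion of A, as the product of the local rings A_p *)
Definition Ahat (x : prodF) : Prop := forall p, cabs (x p) <= 1.

Definition restricted (x : prodF) : bool :=
  `[< finite_set [set p : finplace | ~ (cabs (x p) <= 1)] >].

Lemma cabsB_le1 p (x y : Floc S p) : cabs x <= 1 -> cabs y <= 1 -> cabs (x - y) <= 1.
Proof.
have [h0 he hM hD] := cabsP (Floc S p) => hx hy.
have a1 : cabs (1 : Floc S p) = 1.
  have := hM 1 1; rewrite mulr1 => /esym/eqP; rewrite -subr_eq0.
  rewrite -{3}[cabs 1]mulr1 -mulrBr mulf_eq0 he oner_eq0 /= subr_eq0.
  by move/eqP.
have aN1 : cabs (-1 : Floc S p) = 1.
  have := hM (-1) (-1); rewrite mulrNN mulr1 a1 => /esym/eqP.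
  by rewrite -expr2 sqrp_eq1 // => /eqP.
apply: le_trans (hD _ _) _; rewrite ge_max hx -mulN1r hM aN1 mul1r.
exact: hy.
Qed.

Lemma restricted_subring : subring_closed restricted.
Proof.
split.
- apply/asboolP; apply: (sub_finite_set _ (finite_set0 _)) => p /=; apply.
  have [_ he hM _] := cabsP (Floc S (sval p)).
  rewrite le_eqVlt; apply/orP; left.
  have := hM 1 1; rewrite mulr1 => /esym/eqP; rewrite -subr_eq0.
  rewrite -{3}[cabs 1]mulr1 -mulrBr mulf_eq0 he oner_eq0 /= subr_eq0.
  by [].
- move=> x y /asboolP hx /asboolP hy; apply/asboolP.
  have hU : finite_set ([set p : finplace | ~ (cabs (x p) <= 1)] `|`
                        [set p : finplace | ~ (cabs (y p) <= 1)]).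
    by rewrite finite_setU.
  apply: (sub_finite_set _ hU) => p /= h; apply: contrapT => /not_orP[].
  by move=> /contrapT hx1 /contrapT hy1; apply: h; exact: cabsB_le1.
- move=> x y /asboolP hx /asboolP hy; apply/asboolP.
  have hU : finite_set ([set p : finplace | ~ (cabs (x p) <= 1)] `|`
                        [set p : finplace | ~ (cabs (y p) <= 1)]).
    by rewrite finite_setU.
  apply: (sub_finite_set _ hU) => p /= h; apply: contrapT => /not_orP[].
  move=> /contrapT hx1 /contrapT hy1; apply: h.
  have [h0 _ hM _] := cabsP (Floc S (sval p)).
  by rewrite [cabs _]hM mulr_ile1.
Qed.
HB.instance Definition _ := GRing.isSubringClosed.Build prodF restricted
  restricted_subring.

Record adele := MkAdele { adele_val : prodF; adeleP : restricted adele_val }.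
HB.instance Definition _ := [isSub for adele_val].
HB.instance Definition _ := [Choice of adele by <:].
HB.instance Definition _ := GRing.SubChoice_isSubComPzRing.Build prodF restricted
  adele restricted_subring.

End Adeles.

Section Forms.
Variables (R : realType) (S : setting R) (N : idealr (A S)) (r : nat).

Local Notation C := (Cinf S).
Local Notation CA := (resA (CF S)).
Local Notation prodF := (prodF S).

Definition PsiDom : set 'rV[C]_r :=
  [set psi | forall a : 'I_r -> Finf S,
     \sum_i FinftoC (a i) * psi 0 i = 0 -> forall i, a i = 0].

(* The standard affinoids |pi|^n max_j |w_j| <= |l(w)|, l running over the
   unimodular F_oo-linear forms; they exhaust Omega^r admissibly. *)
Definition Omega_aff (n : nat) : set 'rV[C]_r :=
  [set w | forall a : 'I_r -> Finf S,
     (forall i, absinf (a i) <= 1) -> (exists i, absinf (a i) = 1) ->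
     forall j, abs_unif S ^+ n * absC (w 0 j)
               <= absC (\sum_i FinftoC (a i) * w 0 i)].

(* the corresponding affinoids of Omega^r x C_oo^* in the coordinates psi *)
Definition Psi_aff (n : nat) : set 'rV[C]_r :=
  [set psi | Omega_aff n psi /\ forall i : 'I_r, i.+1 = r ->
     abs_unif S ^+ n <= absC (psi 0 i) <= (abs_unif S ^+ n)^-1].

(* On each (reduced) affinoid, the regular functions are the uniform limits
   of rational functions without poles. *)
Definition holomorphic_on_Psi (h : 'rV[C]_r -> C) : Prop :=
  forall (n : nat) (e : R), 0 < e -> exists P Q : mpoly.mpoly r C,
    forall psi, Psi_aff n psi ->
      mpoly.meval (fun i => psi 0 i) Q != 0 /\
      absC (h psi - mpoly.meval (fun i => psi 0 i) P
                    / mpoly.meval (fun i => psi 0 i) Q) <= e.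

Definition adelic_lat (g : 'M[adele S]_r) : set 'cV[prodF]_r :=
  [set x | exists2 y : 'cV[prodF]_r, forall i, Ahat (y i 0) & x = map_mx val g *m y].

(* F^r \cap g \hat A^r *)
Definition rat_lat (g : 'M[adele S]_r) : set 'cV[F S]_r :=
  [set x | adelic_lat g (map_mx (@principal R S) x)].

Definition psi_map (psi : 'rV[C]_r) (x : 'cV[F S]_r) : C :=
  (psi *m map_mx (@FtoC R S) x) 0 0.

(* the graph { (l, m) | alpha(l) = m } of the isomorphism alpha attached to
   (psi, g): x represents l, y in N^-1(F^r \cap g \hat A^r) is congruent to
   g x modulo g \hat A^r, and m is the class of psi y *)
Definition theta_graph (psi : 'rV[C]_r) (g : 'M[adele S]_r) (L : lattice S)
    (l : Wr N r) (m : torsN N L) : Prop :=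
  exists (x : 'I_r -> subm (NinvP N)) (y : 'cV[F S]_r) (z : subm (Ninv_lat N L)),
    [/\ forall i, l i = cls (AsetP S) (x i),
        Ninv_mul N (rat_lat g) y,
        adelic_lat g
          (map_mx val g *m map_mx (@principal R S) (\col_i (val (x i) : F S))
           - map_mx (@principal R S) y),
        val z = psi_map psi y
      & m = cls L z].

(* Theta([psi, g]) = (Lambda, alpha) with alpha^-1 = iota *)
Definition is_Theta (psi : 'rV[C]_r) (g : 'M[adele S]_r) (x : lpair N r) : Prop :=
  (forall z : C, z \in (Lam x : {pred CA}) <->
     exists2 v, rat_lat g v & z = psi_map psi v) /\
  (forall l m, theta_graph psi g l m <-> iota x m = l).

(* Theta([psi, g]) exists and is unique, so h is psi |-> f (Theta([psi, g])). *)
Definition holomorphic_form (f : lpair N r -> C) : Prop :=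
  forall g : GL r (adele S), exists2 h, holomorphic_on_Psi h &
    forall psi x, PsiDom psi -> is_Theta psi g x -> f x = h psi.

Definition continuous_form (f : lpair N r -> C) : Prop :=
  forall x (e : R), 0 < e -> exists2 d, 0 < d &
    forall y, dist x y < d -> absC (f x - f y) < e.

Definition homogeneous (k : nat) (f : lpair N r -> C) : Prop :=
  forall (t : C) (t0 : t != 0) x, f (tact t0 x) = t ^- k * f x.

Definition Strong_wt (k : nat) : set (lpair N r -> C) :=
  [set f | [/\ continuous_form f, homogeneous k f & holomorphic_form f]].

(* The sum of the weight spaces inside the space of all functions; it is
   direct because forms of different weights are linearly independent. *)
Definition Strong : set (lpair N r -> C) :=
  [set f | exists (n : nat) (fk : nat -> lpair N r -> C),
     (forall k, Strong_wt k (fk k)) /\ forall x, f x = \sum_(k < n) fk k x].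

Definition cuspidal : set (lpair N r -> C) :=
  [set f | forall x n, has_rank [set z | z \in (Lam x : {pred CA})] n ->
     (n < r)%N -> f x = 0].

Definition Cusp_wt (k : nat) : set (lpair N r -> C) := Strong_wt k `&` cuspidal.
Definition Cusp : set (lpair N r -> C) := Strong `&` cuspidal.

Definition slash (f : lpair N r -> C) (g : GL r {ideal_quot N}) : lpair N r -> C :=
  fun x => f (glact g x).

End Forms.

(* Main.v *)
Require Import Defs.
From HB Require Import structures.
From mathcomp Require Import all_boot all_order all_algebra.
From mathcomp Require Import boolp classical_sets functions cardinality fsbigop reals.

Import Order.TTheory GRing.Theory Num.Theory.
Local Open Scope ring_scope.

Set Implicit Arguments.
Unset Strict Implicit.
Unset Printing Implicit Defensive.

(** The right action laws, the homogeneity and the vanishing on lower rank only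
use that [glact] is an action that commutes with scaling and leaves the lattice
untouched.  Continuity is preserved because [glact g] is an isometry: it
permutes the summands of the level part of the metric ([dist_glact]).

Holomorphy is the one point with arithmetic content.  It is tested along the
charts [psi |-> Theta([psi, g])], so each chart must be carried to another one.
Write [d'] for the inverse of [d] in GL_r(A/N).  If [k] in GL_r of the profinite
completion of A reduces to [d'] modulo N, then [g k] and [g] span the same
adelic lattice, while the level structure of [Theta([psi, g])] is precomposed
with [d']; hence [d . Theta([psi, g]) = Theta([psi, g k])]
([theta_graph_mulr], [is_Theta_glact]), and a holomorphic chart function of [f]
at [g k] is one of [f | d] at [g].

There remains to lift GL_r(A/N) to GL_r of the completion ([unit_lift]).  This
needs no approximation theorem, since the completion is a product of local
rings and the lift may be chosen place by place.  Let [c] be a matrix over A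
lifting [d'].  At a place where N^-1 is integral, congruences modulo N are
empty and the identity is a lift.  At any other place all of N has absolute
value less than 1; as [det c] is invertible modulo N, it is a local unit
([loc_int_unit]), and [c] itself is a lift. *)

(* [iota] would otherwise be the enumeration of an interval of integers. *)
Local Notation iota := Defs.iota.

(** * The action on lattices with level structure *)

Lemma GL_inv_exists (r : nat) (K : pzRingType) (g : GL r K) :
  exists h : GL r K, g *m h = 1%:M /\ h *m g = 1%:M.
Proof.
by case: g => g [h [gh hg]]; exists (@MkGL r K h (ex_intro _ g (conj hg gh))).
Qed.

Section Isometry.
Variables (R : realType) (S : setting R) (N : idealr (A S)) (r : nat).
Local Notation GLN := (GL r {ideal_quot N}).

Lemma lpair_eq (L : lattice S) hr1 hr2 (i1 i2 : torsN N L -> Wr N r)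
    l1 l2 (j1 : injective i1) (j2 : injective i2) : i1 = i2 ->
  @LPair R S N r L hr1 i1 l1 j1 = @LPair R S N r L hr2 i2 l2 j2.
Proof.
move=> e; move: l1 j1; rewrite e => l1 j1.
by rewrite (Prop_irrelevance hr1 hr2) (Prop_irrelevance l1 l2)
  (Prop_irrelevance j1 j2).
Qed.

Lemma glact1 (x : lpair N r) : glact (GL1 r _) x = x.
Proof.
case: x => L hr i li ji; apply: lpair_eq; apply/funext => q /=.
exact: mxact1.
Qed.

Lemma glactM (g h : GLN) (x : lpair N r) :
  glact (GLM g h) x = glact g (glact h x).
Proof. by apply: lpair_eq; apply/funext => q /=; rewrite mxactM. Qed.

Lemma glact_tact (g : GLN) (t : Cinf S) (t0 : t != 0) (x : lpair N r) :
  glact g (tact t0 x) = tact t0 (glact g x).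
Proof. exact: lpair_eq. Qed.

Lemma mxact0 (g : 'M[{ideal_quot N}]_r) : mxact g 0 = 0.
Proof.
apply/ffunP => i; rewrite !ffunE big1 // => j _.
by rewrite ffunE /qact scaler0.
Qed.

Lemma mxact_bij (g : GLN) : bijective (mxact g).
Proof.
have [h [gh hg]] := GL_inv_exists g.
by exists (mxact h) => l; rewrite mxactM ?gh ?hg mxact1.
Qed.

(** Both sides evaluate the exponential of the same lattice at the same torsion
class: since [g] is injective, the preimage of [mxact g l] under the new level
structure is the preimage of [l] under the old one. *)
Lemma mu_glact (g : GLN) (x : lpair N r) (l : Wr N r) :
  mu (glact g x) (mxact g l) = mu x l.
Proof.
have E : (fun m => iota (glact g x) m = mxact g l) = (fun m => iota x m = l).
  by apply/funext => m; apply/propext; split=> [/mxact_inj|/= ->].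
have E0 : (mxact g l <> 0) = (l <> 0).
  apply/propext; split=> h e; apply: h; first by rewrite e mxact0.
  by apply: (mxact_inj (g := g)); rewrite mxact0.
by rewrite /mu /mkset E E0.
Qed.

Lemma dist_glact (g : GLN) (x y : lpair N r) :
  dist (glact g x) (glact g y) = dist x y.
Proof.
rewrite /dist; congr (_ + _).
rewrite (reindex_fsbigT (mxact g)) /=; last exact: mxact_bij.
by apply: eq_fsbigr => l _; rewrite !mu_glact.
Qed.

End Isometry.

(** * Local integrality *)

Section Adelic.
Variables (R : realType) (S : setting R).
Local Notation emb p := (cemb (Floc S (sval p))).

Section Place.
Variable p : finplace S.
Local Notation Fp := (Floc S (sval p)).
Local Notation emb := (cemb Fp).

Definition loc_int (x : Fp) : bool := cabs x <= 1.

Lemma loc_abs_eq0 (x : Fp) : (cabs x == 0) = (x == 0).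
Proof. by have [_ ->] := cabsP Fp. Qed.

Lemma loc_absM (x y : Fp) : cabs (x * y) = cabs x * cabs y.
Proof. by have [_ _ ->] := cabsP Fp. Qed.

Lemma loc_abs1 : cabs (1 : Fp) = 1.
Proof.
apply: (@mulfI _ (cabs (1 : Fp))); first by rewrite loc_abs_eq0 oner_eq0.
by rewrite -loc_absM !mulr1.
Qed.

Lemma loc_absV (x : Fp) : cabs x^-1 = (cabs x)^-1.
Proof.
have [->|x0] := eqVneq x 0.
  have /eqP e0 : cabs (0 : Fp) == 0 by rewrite loc_abs_eq0.
  by rewrite invr0 e0 invr0.
apply: (@mulfI _ (cabs x)); first by rewrite loc_abs_eq0.
by rewrite -loc_absM !divff ?loc_abs1 // loc_abs_eq0.
Qed.

Lemma loc_int_subring : subring_closed loc_int.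
Proof.
split.
- by rewrite /in_mem /= /loc_int loc_abs1.
- exact: cabsB_le1.
- move=> x y; rewrite /in_mem /= /loc_int => hx hy.
  by rewrite loc_absM mulr_ile1; have [h0] := cabsP Fp.
Qed.
HB.instance Definition _ := GRing.isSubringClosed.Build Fp loc_int
  loc_int_subring.

Definition loc_comp (x : prodF S) : Fp := x p.
Lemma loc_comp_zmod_morphism : zmod_morphism loc_comp.
Proof. by []. Qed.
Lemma loc_comp_monoid_morphism : monoid_morphism loc_comp.
Proof. by []. Qed.
HB.instance Definition _ := GRing.isZmodMorphism.Build (prodF S) Fp loc_comp
  loc_comp_zmod_morphism.
HB.instance Definition _ := GRing.isMonoidMorphism.Build (prodF S) Fp loc_comp
  loc_comp_monoid_morphism.

Lemma regular_loc_int (x : F S) : regular x -> emb x \in loc_int.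
Proof.
move=> /asboolP /(_ _ (svalP p)); rewrite /in_mem /= /loc_int cemb_isom.
rewrite /place_abs /val_ge; case: eqP => //= _ v0.
have q1 : 1 < #|const S|%:R :> R by rewrite ltr1n card_finNzRing_gt1.
by rewrite mul1r -[leRHS](expr0z (#|const S|%:R : R)) ler_eXz2l // oppr_le0.
Qed.

(** Choose [x] in N^-1 with |x| > 1.  For [n] in N the product [n x] is regular,
so |n| < 1; applied to [n = 1 - d d'], this forces |d d'| = 1 by the ultrametric
inequality, and both factors have absolute value at most 1. *)
Lemma loc_int_unit (N : idealr (A S)) (x : F S) (d d' : A S) :
  Ninv N x -> emb x \notin loc_int -> 1 - d * d' \in N ->
  cabs (emb (val d)) = 1.
Proof.
have [h0 he hM hD] := cabsP Fp.
have intA (a : A S) : cabs (emb (val a)) <= 1.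
  exact: (regular_loc_int (AvalP a)).
move=> /asboolP hx; rewrite /in_mem /= /loc_int -ltNge => x1 nN.
have n1 : cabs (emb (val (1 - d * d'))) < 1.
  rewrite ltNge; apply/negP => n1.
  have := regular_loc_int (hx _ nN).
  rewrite /in_mem /= /loc_int rmorphM hM => /le_lt_trans /(_ x1).
  by rewrite gtr_pMl ?(lt_trans ltr01) // ltNge n1.
apply/eqP; rewrite eq_le intA leNgt /=; apply/negP => d1.
have dd1 : cabs (emb (val (d * d'))) < 1.
  rewrite !rmorphM hM; apply: le_lt_trans d1.
  by rewrite ler_piMr.
have := hD (emb (val (1 - d * d'))) (emb (val (d * d'))).
by rewrite -!rmorphD subrK !rmorph1 loc_abs1 leNgt gt_max n1 dd1.
Qed.

End Place.

(** * Integral adelic matrices and the lattices they span *)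

Section Matrices.
Variable r : nat.
Local Notation prodF := (prodF S).

Definition hat_mx m n (M : 'M[prodF]_(m, n)) : Prop := forall i j, Ahat (M i j).

Lemma hat_mxB m n (M M' : 'M[prodF]_(m, n)) :
  hat_mx M -> hat_mx M' -> hat_mx (M - M').
Proof.
move=> h h' i j p; rewrite !mxE.
exact: (rpredB (h i j p : _ \in @loc_int p) (h' i j p : _ \in @loc_int p)).
Qed.

Lemma hat_mxM m n k (M : 'M[prodF]_(m, n)) (M' : 'M[prodF]_(n, k)) :
  hat_mx M -> hat_mx M' -> hat_mx (M *m M').
Proof.
move=> h h' i j p; rewrite mxE -/(loc_comp p _) rmorph_sum.
rewrite -[_ <= 1]/(_ \in @loc_int p); apply: rpred_sum => u _.
exact: (rpredM (h i u p : _ \in @loc_int p) (h' u j p : _ \in @loc_int p)).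
Qed.

Lemma adelic_latP (g : 'M[adele S]_r) x :
  adelic_lat g x <-> exists2 y, hat_mx y & x = map_mx val g *m y.
Proof.
by split=> -[y hy ->]; exists y => // i j; rewrite (ord1 j); exact: hy.
Qed.

Lemma adelic_latB (g : 'M[adele S]_r) x y :
  adelic_lat g x -> adelic_lat g y -> adelic_lat g (x - y).
Proof.
move=> /adelic_latP[u hu ->] /adelic_latP[v hv ->]; apply/adelic_latP.
by exists (u - v); [exact: hat_mxB | rewrite mulmxBr].
Qed.

Lemma adelic_latD (g : 'M[adele S]_r) x y :
  adelic_lat g x -> adelic_lat g y -> adelic_lat g (x + y).
Proof.
move=> hx hy; have -> : x + y = x - ((y - y) - y) by rewrite subrr sub0r opprK.
by do !apply: adelic_latB.
Qed.

Lemma adelic_lat_mulr (g k k' : 'M[adele S]_r) :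
  hat_mx (map_mx val k) -> hat_mx (map_mx val k') -> k *m k' = 1%:M ->
  adelic_lat (g *m k) = adelic_lat g.
Proof.
move=> hk hk' kk'; apply/funext => x; apply/propext; split=> /adelic_latP[y hy ->];
  apply/adelic_latP.
  by exists (map_mx val k *m y); [exact: hat_mxM | rewrite mulmxA -map_mxM].
exists (map_mx val k' *m y); first exact: hat_mxM.
by rewrite mulmxA -map_mxM -mulmxA kk' mulmx1.
Qed.

(** The components may be prescribed independently: integrality everywhere makes
the restricted product condition void. *)
Lemma adele_mx_exists (K : forall p : finplace S, 'M[Floc S (sval p)]_r) :
  (forall p i j, K p i j \in @loc_int p) ->
  exists k : 'M[adele S]_r, forall p, map_mx (loc_comp p \o val) k = K p.
Proof.
move=> hK.
have hat i j : Ahat (fun p => K p i j) by move=> p; exact: hK.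
have rst i j : restricted (fun p => K p i j : Floc S (sval p)).
  apply/asboolP; apply: (sub_finite_set _ (finite_set0 _)) => p /=; apply.
  exact: hat.
exists (\matrix_(i, j) MkAdele (rst i j)) => p.
by apply/matrixP => i j; rewrite !mxE.
Qed.

Lemma adele_mx_eq (k k' : 'M[adele S]_r) :
  (forall p, map_mx (loc_comp p \o val) k = map_mx (loc_comp p \o val) k') ->
  k = k'.
Proof.
move=> e; apply/matrixP => i j; apply: val_inj.
apply: functional_extensionality_dep => p.
by have /matrixP/(_ i j) := e p; rewrite !mxE.
Qed.

(** * Lifting the level group *)

Variable N : idealr (A S).

Definition numerators (x : 'I_r -> subm (NinvP N)) : 'cV[F S]_r :=
  \col_i (val (x i) : F S).

(** The congruence of [k] with [d] modulo N, expressed by the actions of the two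
matrices on (N^-1/A)^r: this is the form in which level structures use it, and
it avoids extending N to the adeles. *)
Definition reduces_to (k : 'M[adele S]_r) (d : 'M[{ideal_quot N}]_r) : Prop :=
  forall x x' : 'I_r -> subm (NinvP N),
    mxact d [ffun i => cls (AsetP S) (x i)] = [ffun i => cls (AsetP S) (x' i)] ->
    hat_mx (map_mx val k *m map_mx (@principal R S) (numerators x)
            - map_mx (@principal R S) (numerators x')).

(** The lift is [c] at the places where N^-1 has a nonintegral element and the
identity elsewhere, where [c] is an entrywise lift of [d] to A; the inverse is
given by the adjugate of [c], whose entries also lie in A. *)
Lemma unit_lift (d : GL r {ideal_quot N}) :
  exists k k' : 'M[adele S]_r,
    [/\ hat_mx (map_mx val k), hat_mx (map_mx val k'), k *m k' = 1%:M,
        k' *m k = 1%:M & reduces_to k d].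
Proof.
have [d' [dd' d'd]] := GL_inv_exists d.
pose c : 'M[A S]_r := map_mx (@generic_quotient.repr _ {ideal_quot N}) d.
pose c' : 'M[A S]_r := map_mx (@generic_quotient.repr _ {ideal_quot N}) d'.
have cc' : 1 - \det c * \det c' \in N.
  rewrite Quotient.idealrBE; apply/eqP.
  pose pi : {rmorphism A S -> {ideal_quot N}} := \pi_{ideal_quot N}%qT.
  have pic (e : 'M[{ideal_quot N}]_r) :
      map_mx pi (map_mx (@generic_quotient.repr _ {ideal_quot N}) e) = e.
    by apply/matrixP => i j; rewrite !mxE /= reprK.
  rewrite -[LHS]/(pi _) -[RHS]/(pi _) rmorph1 -det_mulmx -det_map_mx map_mxM.
  by rewrite !pic dd' det1.
pose e (p : finplace S) : {rmorphism A S -> Floc S (sval p)} := emb p \o val.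
have eint p a : e p a \in @loc_int p by exact: regular_loc_int (AvalP a).
pose bad p := `[< exists2 x, Ninv N x & emb p x \notin @loc_int p >].
have abs_detc p : bad p -> cabs (e p (\det c)) = 1.
  by move=> /asboolP[x hx nx]; exact: loc_int_unit hx nx cc'.
pose K p := if bad p then map_mx (e p) c else 1%:M.
pose K' p := if bad p then (e p (\det c))^-1 *: map_mx (e p) (\adj c) else 1%:M.
have hK p i j : K p i j \in @loc_int p.
  rewrite /K; case: (bad p); rewrite mxE //.
  by case: (i == j); [exact: rpred1 | exact: rpred0].
have hK' p i j : K' p i j \in @loc_int p.
  rewrite /K'; case: ifP => [/abs_detc ec|_]; last first.
    by rewrite mxE; case: (i == j); [exact: rpred1 | exact: rpred0].
  rewrite mxE [map_mx _ _ i j]mxE; apply: rpredM; last exact: eint.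
  by rewrite /in_mem /= /loc_int loc_absV ec invr1.
have [k kE] := adele_mx_exists hK.
have [k' k'E] := adele_mx_exists hK'.
have KK' p : K p *m K' p = 1%:M /\ K' p *m K p = 1%:M.
  rewrite /K /K'; case: ifP => [/abs_detc ec|_]; last by rewrite mulmx1.
  have u : e p (\det c) != 0.
    by rewrite -loc_abs_eq0 ec oner_eq0.
  rewrite -scalemxAr -scalemxAl -!map_mxM mul_mx_adj mul_adj_mx.
  by rewrite map_scalar_mx scale_scalar_mx mulVf.
exists k, k'; split.
- move=> i j p; have /matrixP/(_ i j) := kE p; rewrite !mxE /= /loc_comp => ->.
  exact: hK.
- move=> i j p; have /matrixP/(_ i j) := k'E p; rewrite !mxE /= /loc_comp => ->.
  exact: hK'.
- by apply: adele_mx_eq => p; rewrite map_mxM kE k'E map_mx1 (KK' p).1.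
- by apply: adele_mx_eq => p; rewrite map_mxM kE k'E map_mx1 (KK' p).2.
move=> x x' hx i j p; rewrite (ord1 j) {j}.
set u := fun_of_matrix _ i 0; rewrite -[_ <= 1]/(loc_comp p u \in @loc_int p).
have -> : loc_comp p u =
    \sum_j K p i j * emb p (val (x j)) - emb p (val (x' i)).
  rewrite /u mxE [X in _ + X]mxE rmorphB mxE rmorph_sum; congr (_ - _).
    by apply: eq_bigr => j _; rewrite -kE !mxE.
  by rewrite /= !mxE.
rewrite /K; case: ifP => [_|/negbT/asboolP nbad].
  have -> : \sum_j map_mx (e p) c i j * emb p (val (x j)) - emb p (val (x' i)) =
      emb p (\sum_j val (c i j) * val (x j) - val (x' i)).
    rewrite rmorphB rmorph_sum; congr (_ - _).
    by apply: eq_bigr => j _; rewrite mxE [RHS]rmorphM.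
  apply: regular_loc_int.
  have /ffunP/(_ i) := hx; rewrite !ffunE.
  under eq_bigr do rewrite ffunE /qact -clsZ.
  have cls0 : cls (AsetP S) (0 : subm (NinvP N)) = 0 by exact: raddf0.
  rewrite -(big_morph _ (@clsD _ _ _ (AsetP S)) cls0) => /cls_eq.
  rewrite raddfB raddf_sum /= => h.
  by congr regular: h; congr (_ - _); apply: eq_bigr => j _; rewrite !mxE.
(* Here k is the identity and N^-1 is integral at p, so each term is integral. *)
have good (y : subm (NinvP N)) : emb p (val y) \in @loc_int p.
  apply: contrapT => ny; apply: nbad; exists (val y); last exact/negP.
  exact: (submP y).
apply: rpredB; last exact: good.
rewrite (bigD1 i) //= mxE eqxx mul1r big1 ?addr0; first exact: good.
by move=> j ji; rewrite mxE eq_sym (negPf ji) mul0r.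
Qed.

(** * Translating the uniformisation *)

(** The matrix [k] preserves integral vectors, so the lattices of [g k] and [g]
agree; and [k] moves a representative of [l] to a representative of [d l], up to
an integral vector. *)
Lemma theta_graph_mulr (psi : 'rV[Cinf S]_r) (g k k' : 'M[adele S]_r)
    (d : 'M[{ideal_quot N}]_r) (L : lattice S) l m :
  hat_mx (map_mx val k) -> hat_mx (map_mx val k') -> k *m k' = 1%:M ->
  reduces_to k d ->
  theta_graph psi (g *m k) (L := L) l m <-> theta_graph psi g (mxact d l) m.
Proof.
move=> hk hk' kk' kd.
have lat_gk : adelic_lat (g *m k) = adelic_lat g by exact: adelic_lat_mulr kk'.
have rat_gk : rat_lat (g *m k) = rat_lat g by rewrite /rat_lat lat_gk.
pose X (x : 'I_r -> subm (NinvP N)) := map_mx (@principal R S) (numerators x).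
have shift x x' : (forall i, l i = cls (AsetP S) (x i)) ->
    (forall i, mxact d l i = cls (AsetP S) (x' i)) ->
    adelic_lat g (map_mx val (g *m k) *m X x - map_mx val g *m X x').
  move=> hx hx'; apply/adelic_latP; exists (map_mx val k *m X x - X x').
    apply: kd; transitivity (mxact d l).
      by congr mxact; apply/ffunP => i; rewrite ffunE hx.
    by apply/ffunP => i; rewrite [RHS]ffunE hx'.
  by rewrite mulmxBr mulmxA -map_mxM.
split=> -[x [y [z [hx hy hlat hz hm]]]].
  have hx' i : mxact d l i = cls (AsetP S) (rep (mxact d l i)) by rewrite repK.
  exists (fun i => rep (mxact d l i)), y, z; split=> //; first by rewrite -rat_gk.
  rewrite lat_gk in hlat; have := adelic_latB hlat (shift _ _ hx hx').
  by rewrite opprB addrC addrA subrK.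
have hx' i : l i = cls (AsetP S) (rep (l i)) by rewrite repK.
exists (fun i => rep (l i)), y, z; split=> //; first by rewrite rat_gk.
rewrite lat_gk; have := adelic_latD (shift _ _ hx' hx) hlat.
by rewrite addrA subrK.
Qed.

(** The inverse of [d] is lifted, because the level structure of [Theta] points
from (N^-1/A)^r to the torsion whereas [iota] is its inverse. *)
Lemma is_Theta_glact (d : GL r {ideal_quot N}) (g : GL r (adele S)) :
  exists g' : GL r (adele S), forall psi (x : lpair N r),
    is_Theta psi g x -> is_Theta psi g' (glact d x).
Proof.
have [d' [dd' d'd]] := GL_inv_exists d.
have [k [k' [hk hk' kk' k'k kd]]] := unit_lift d'.
pose kGL : GL r (adele S) := MkGL (ex_intro _ k' (conj kk' k'k)).
exists (GLM g kGL) => psi x [hlat hgraph]; split=> [z|l m] /=.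
  by rewrite hlat /rat_lat (adelic_lat_mulr g hk hk' kk').
apply: iff_trans (theta_graph_mulr _ _ _ _ hk hk' kk' kd) _.
apply: iff_trans (hgraph _ _) _ => /=.
by split=> [->|<-]; rewrite mxactM ?dd' ?d'd mxact1.
Qed.

End Matrices.
End Adelic.

(** * The slash operator *)

Section Slash.
Variables (R : realType) (S : setting R) (N : idealr (A S)) (r : nat).
Variable g : GL r {ideal_quot N}.
Implicit Types f : lpair N r -> Cinf S.

Lemma slash_continuous f : continuous_form f -> continuous_form (slash f g).
Proof.
move=> fc x e /(fc (glact g x))[d d0 hd]; exists d => // y.
by rewrite -(dist_glact g) => /hd.
Qed.

Lemma slash_homogeneous k f : homogeneous k f -> homogeneous k (slash f g).
Proof. by move=> fh t t0 x; rewrite /slash glact_tact fh. Qed.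

Lemma slash_holomorphic f : holomorphic_form f -> holomorphic_form (slash f g).
Proof.
move=> fh u; have [u' hu'] := is_Theta_glact g u.
have [h hh fE] := fh u'; exists h => // psi x psiP /hu'; exact: fE.
Qed.

Lemma slash_Strong_wt k f : Strong_wt k f -> Strong_wt k (slash f g).
Proof.
move=> [fc fh fo]; split.
- exact: slash_continuous.
- exact: slash_homogeneous.
- exact: slash_holomorphic.
Qed.

Lemma slash_Strong f : Strong f -> Strong (slash f g).
Proof.
move=> [n [fk [fkS fE]]]; exists n, (fun k => slash (fk k) g); split=> [k|x].
  exact: slash_Strong_wt.
exact: fE.
Qed.

Lemma slash_cuspidal f : cuspidal f -> cuspidal (slash f g).
Proof. by move=> fc x; exact: fc (glact g x). Qed.

End Slash.

Theorem proposition10 (R : realType) (S : setting R) (r : nat) (hr : (1 <= r)%N)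
    (N : idealr (A S)) (hN : exists2 n : A S, n \in N & n != 0) :
  (forall (g : GL r {ideal_quot N}) (f : lpair N r -> Cinf S),
     Strong f -> Strong (slash f g))
  /\ (forall f : lpair N r -> Cinf S, Strong f -> slash f (GL1 r {ideal_quot N}) = f)
  /\ (forall (g h : GL r {ideal_quot N}) (f : lpair N r -> Cinf S), Strong f ->
       slash f (GLM g h) = slash (slash f g) h)
  /\ (forall (g : GL r {ideal_quot N}) (c : Cinf S) (f1 f2 : lpair N r -> Cinf S),
       Strong f1 -> Strong f2 ->
       slash (fun x => c * f1 x + f2 x) g
         = (fun x => c * slash f1 g x + slash f2 g x))
  /\ (forall (g : GL r {ideal_quot N}) (k : nat) (f : lpair N r -> Cinf S),
       Strong_wt k f -> Strong_wt k (slash f g))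
  /\ (forall (g : GL r {ideal_quot N}) (k : nat) (f : lpair N r -> Cinf S),
       Cusp_wt k f -> Cusp_wt k (slash f g))
  /\ (forall (g : GL r {ideal_quot N}) (f : lpair N r -> Cinf S),
       Cusp f -> Cusp (slash f g)).
Proof.
split; first by move=> g f; exact: slash_Strong.
split; first by move=> f _; apply/funext => x; rewrite /slash glact1.
split; first by move=> g h f _; apply/funext => x; rewrite /slash glactM.
split; first by [].
split; first by move=> g k f; exact: slash_Strong_wt.
by split=> [g k f [fS fc]|g f [fS fc]]; split;
  [exact: slash_Strong_wt | exact: slash_cuspidal
  |exact: slash_Strong | exact: slash_cuspidal].
Qed.
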